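(* For $n\geq 3$, a transformation of coordinates $\widetilde{x}^{i}=\widetilde{x}^{i}(x^{1},\dots,x^{n})$, $\widetilde{y}^{i}=\sum_{j=1}^{n}\frac{\partial\widetilde{x}^{i}}{\partial x^{j}}\,y^{j}$ ($i=1,\dots,n$), with $\det\left(\partial\widetilde{x}^{i}/\partial x^{j}\right)\neq 0$, leaves invariant the Berwald-Moór metric $F_n(y)=\sqrt[n]{y^{1}y^{2}\cdots y^{n}}$ if and only if there exist some arbitrary real numbers $a_{1},a_{2},\dots,a_{n}$ verifying the equality $\prod_{i=1}^{n}a_{i}=1$, together with a permutation $\sigma\in S_{n}$ of the set $\{1,2,\dots,n\}$, such that $$\widetilde{\mathcal{X}}=\mathcal{P}_{\sigma}(a_{1},a_{2},\dots,a_{n})\cdot\mathcal{X}+\mathcal{X}_{0},$$ where $\mathcal{X}_{0}=(x_0^1,x_0^2,\dots,x_0^n)^{T}\in M_{n,1}(\mathbb{R})$, $\mathcal{X}=(x^{1},x^{2},\dots,x^{n})^{T}$, $\widetilde{\mathcal{X}}=(\widetilde{x}^{1},\widetilde{x}^{2},\dots,\widetilde{x}^{n})^{T}$, and the matrix $\mathcal{P}_{\sigma}(a_{1},a_{2},\dots,a_{n})$ has all entries equal to zero except the entries $p_{1\sigma(1)}=a_{1},\ p_{2\sigma(2)}=a_{2},\ \dots,\ p_{n\sigma(n)}=a_{n}$.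
   Context: Here $(x,y)=(x^{i},y^{i})$, $i=1,\dots,n$, are the coordinates of the tangent bundle $TM^{n}$ associated to an $n$-dimensional real manifold $M^{n}$, and the transformations of coordinates considered are the coordinate changes on $TM^n$ of the form displayed in the claim. The Berwald-Moór metric of order $n$ is the function $F_n$ on $TM^{n}$ given by $F_n(y)=\sqrt[n]{y^{1}y^{2}\cdots y^{n}}$. A transformation of coordinates leaves it invariant if $F_n(\widetilde{y})=F_n(y)$, which means that $\widetilde{y}^{1}\widetilde{y}^{2}\cdots\widetilde{y}^{n}=y^{1}y^{2}\cdots y^{n}$. $S_n$ denotes the set of permutations of $\{1,2,\dots,n\}$, and $M_{n,1}(\mathbb{R})$ the set of real $n\times 1$ column matrices.
   Formalization: The transformation of coordinates is taken to be C^1 on a connected open domain; on a disconnected domain the claim fails, since the translation X_0 (or the matrix P_σ) may differ between components. *)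

(* Defs.v *)
From mathcomp Require Export all_boot all_order all_algebra all_fingroup.
From mathcomp Require Export all_classical all_reals all_analysis.
Export numFieldNormedType.Exports.
Export Order.TTheory GRing.Theory Num.Theory.

Set Implicit Arguments.
Unset Strict Implicit.
Unset Printing Implicit Defensive.

Local Open Scope classical_set_scope.
Local Open Scope ring_scope.

Section BerwaldMoor.
Variables (R : realType) (n : nat).

(* The real [n]-th root as a partial function: for odd [n] it is defined
   everywhere (and odd), for even [n] only on the nonnegative reals; [None]
   means "undefined". *)
Definition real_root (p : R) : option R :=
  if odd n || (0 <= p) then Some (Num.sg p * `|p| `^ (n%:R^-1)) else None.

Definition berwald_moor (y : 'cV[R]_n) : option R :=
  real_root (\prod_(i < n) y i ord0).

Implicit Types (U : set 'cV[R]_n) (f : 'cV[R]_n -> 'cV[R]_n).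

Definition partial_derivative f (i j : 'I_n) (x : 'cV[R]_n) : R :=
  'D_(delta_mx j ord0) (fun z : 'cV[R]_n => f z i ord0) x.

Definition jacobian_mx f (x : 'cV[R]_n) : 'M[R]_n :=
  \matrix_(i, j) partial_derivative f i j x.

(* Only the values of [f] on the domain [U] matter. The conditions say that [U]
   is a connected open set and that [f] is of class C^1 on [U] with invertible
   Jacobian matrix; connectedness is needed since on a disconnected domain the
   constants of an affine description could differ between components. *)
Record coordinate_change U f : Prop := CoordinateChange {
  coordinate_change_open : open U;
  coordinate_change_connected : connected U;
  coordinate_change_differentiable : forall x, U x -> differentiable f x;
  coordinate_change_C1 : forall (i j : 'I_n) x, U x ->
    {for x, continuous (partial_derivative f i j)};
  coordinate_change_det : forall x, U x -> \det (jacobian_mx f x) != 0 }.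

Definition tangent_change f (xy : 'cV[R]_n * 'cV[R]_n) :
    'cV[R]_n * 'cV[R]_n :=
  (f xy.1, jacobian_mx f xy.1 *m xy.2).

(* Equality of partial functions: both sides are undefined, or both are defined
   and equal. *)
Definition leaves_berwald_moor_invariant U f : Prop :=
  forall x y : 'cV[R]_n, U x ->
    berwald_moor (tangent_change f (x, y)).2 = berwald_moor y.

Definition perm_diag_mx (s : 'S_n) (a : 'I_n -> R) : 'M[R]_n :=
  \matrix_(i, j) (if j == s i then a i else 0).

End BerwaldMoor.

(* Main.v *)
Require Import Defs.

Set Implicit Arguments.
Unset Strict Implicit.
Unset Printing Implicit Defensive.

Local Open Scope classical_set_scope.
Local Open Scope ring_scope.

(** The proof has an algebraic half, pointwise in [x], and an analytic half.

    At a fixed [x] let [J] be the Jacobian matrix. Invariance says that the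
    product of the linear forms [(J y)_i] equals the product of the coordinates
    of [y] whenever the latter is nonnegative ([real_root_inj_ge0]). (For even
    [n] the root of a negative product is undefined, so equality of the
    products is not available there; it is used below only where the product
    is [0] or [1].) On the hyperplane [y_j = 0] the product of the forms
    [(J y)_i] vanishes; since a product of nonzero forms is not identically
    zero ([exists_hyperplane_point_prod_neq0]), one of these forms vanishes on
    that hyperplane, so some row of [J] is supported on column [j]. As [J] is
    invertible, different columns [j] use different rows, hence [J] is the
    monomial matrix of a permutation [s] with coefficients [a_i]; evaluating
    at [y = (1, ..., 1)] gives [\prod a_i = 1]
    ([monomial_of_preserves_berwald_moor]).

    It remains to see that [J] does not depend on [x]. A coefficient of [J]
    that is nonzero at [x] stays nonzero nearby by continuity, so [s] is locally
    constant. On a ball for the sup norm, that is, on a box, where [s] is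
    constant, the [i]-th component of the map depends only on the coordinate
    [x_(s i)], hence so does [a_i]; but [a_i] is also the inverse of the product
    of the other [a_k], none of which depends on [x_(s i)]. So all the [a_i] are
    constant on the box ([jacobian_mx_box_constant]). Connectedness of the
    domain makes [J] constant, and a map with constant derivative [A] on a
    connected open set differs from [A] by a constant. *)

(** * Matrices preserving the product of the coordinates *)

Lemma exists_nonroot (R : numFieldType) (p : {poly R}) :
  p != 0 -> exists t, p.[t] != 0.
Proof.
move=> p0; apply/not_existsP => allroot.
pose rs := [seq i%:R : R | i <- iota 0 (size p)].
suff: (size rs < size p)%N by rewrite size_map size_iota ltnn.
apply: max_poly_roots p0 _ _.
  by apply/allP => x _; apply/eqP; apply: contra_notP (allroot x) => /eqP.
rewrite map_inj_uniq ?iota_uniq// => i j /eqP.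
by rewrite eqr_nat => /eqP.
Qed.

(** On the moment curve [y_k = t ^ k], with the [j]-th coordinate replaced by
    [0], each form becomes a nonzero polynomial in [t], and so does their
    product. *)
Lemma exists_hyperplane_point_prod_neq0 (R : numFieldType) (n : nat)
    (A : 'M[R]_n) (j : 'I_n) :
  (forall i, exists2 k, k != j & A i k != 0) ->
  exists2 y : 'cV[R]_n, y j ord0 = 0 & \prod_(i < n) (A *m y) i ord0 != 0.
Proof.
move=> Aj; pose q i : {poly R} := \poly_(k < n)
  oapp (fun k : 'I_n => if k == j then 0 else A i k) 0 (insub k).
have q0 i : q i != 0.
  have [k kj Aik] := Aj i; apply/eqP => /(congr1 (coefp k)).
  rewrite /= coef_poly coef0 ltn_ord valK /= (negPf kj) => /eqP.
  by rewrite (negPf Aik).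
have /exists_nonroot[t] : \prod_(i < n) q i != 0 by apply/prodf_neq0.
rewrite horner_prod => qt.
exists (\col_k (if k == j then 0 else t ^+ k)); first by rewrite mxE eqxx.
congr (_ != 0): qt; apply: eq_bigr => i _.
rewrite horner_poly mxE; apply: eq_bigr => k _.
rewrite valK /= mxE; by case: eqP => _; rewrite ?mul0r ?mulr0.
Qed.

(** A product of linear forms vanishes on a hyperplane only if one of the
    factors does. This assigns to every column [j] a row supported on [j]; the
    assignment is injective as [A] has no zero row. *)
Lemma monomial_of_preserves_hyperplanes (R : realType) (n : nat)
    (A : 'M[R]_n) :
  \det A != 0 ->
  (forall (y : 'cV[R]_n) (j : 'I_n), y j ord0 = 0 ->
     \prod_(i < n) (A *m y) i ord0 = 0) ->
  exists s : 'S_n, A = perm_diag_mx s (fun i => A i (s i)).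
Proof.
move=> detA A0.
have rowj j : {i | forall k, k != j -> A i k = 0}.
  apply/cid; apply: contrapT => noi.
  have [i|y /A0 ->] := exists_hyperplane_point_prod_neq0 (A := A) (j := j).
    apply: contra_notP noi => nok; exists i => k kj.
    by apply/eqP/negPn/negP => Aik; apply: nok; exists k.
  by rewrite eqxx.
pose t j := sval (rowj j).
have tP j k : k != j -> A (t j) k = 0 by exact: (svalP (rowj j)).
have t_inj : injective t.
  move=> j j' tjj'; apply/eqP/negPn/negP => jj'.
  have row0 k : A (t j) k = 0.
    by have [->|/tP//] := eqVneq k j; rewrite tjj' tP.
  by move: detA; rewrite (expand_det_row A (t j)) big1 ?eqxx// => k _;
    rewrite row0 mul0r.
exists (perm t_inj)^-1%g; apply/matrixP => i k; rewrite mxE.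
case: eqP => [->//|/eqP]; rewrite -{2}(permKV (perm t_inj) i) permE.
exact: tP.
Qed.

Lemma perm_diag_mx_mul (R : realType) (n : nat) (s : 'S_n) (a : 'I_n -> R)
    (y : 'cV[R]_n) i :
  (perm_diag_mx s a *m y) i ord0 = a i * y (s i) ord0.
Proof.
rewrite mxE (bigD1 (s i))//= big1 ?addr0 ?mxE ?eqxx// => k /negPf ks.
by rewrite mxE ks mul0r.
Qed.

Lemma prod_perm_diag_mx_mul (R : realType) (n : nat) (s : 'S_n)
    (a : 'I_n -> R) (y : 'cV[R]_n) :
  \prod_(i < n) (perm_diag_mx s a *m y) i ord0 =
  (\prod_(i < n) a i) * \prod_(i < n) y i ord0.
Proof.
rewrite [X in _ * X](reindex_inj (@perm_inj _ s)) -big_split /=.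
by apply: eq_bigr => i _; rewrite perm_diag_mx_mul.
Qed.

(** Only one side is assumed nonnegative: for even [n] a negative [p] has no
    root, for odd [n] it has a negative one. *)
Lemma real_root_inj_ge0 (R : realType) (n : nat) (p q : R) : (0 < n)%N ->
  0 <= q -> real_root n p = real_root n q -> p = q.
Proof.
move=> n0 q0; rewrite /real_root q0 orbT; case: ifP => // _ [].
have n0' : (n%:R^-1 : R) != 0 by rewrite invr_eq0 pnatr_eq0 -lt0n.
have [->|qN0] := eqVneq q 0.
  rewrite sgr0 mul0r => /eqP; rewrite mulf_eq0 sgr_eq0 powR_eq0 normr_eq0.
  by case: eqP.
have qgt0 : 0 < q by rewrite lt_def qN0.
rewrite (gtr0_sg qgt0) mul1r (gtr0_norm qgt0) => e.
have : 0 < Num.sg p * `|p| `^ n%:R^-1 by rewrite e powR_gt0.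
have [->|pN0] := eqVneq p 0; first by rewrite sgr0 mul0r ltxx.
rewrite pmulr_lgt0 ?powR_gt0 ?normr_gt0// sgr_gt0 => pgt0.
move: e; rewrite (gtr0_sg pgt0) mul1r (gtr0_norm pgt0).
move=> /(congr1 (fun x => x `^ n%:R)); rewrite -!powRrM mulVf ?powRr1 ?ltW//.
by rewrite pnatr_eq0 -lt0n.
Qed.

Lemma monomial_of_preserves_berwald_moor (R : realType) (n : nat)
    (A : 'M[R]_n) : (0 < n)%N -> \det A != 0 ->
  (forall y, berwald_moor (A *m y) = berwald_moor y) ->
  exists2 s : 'S_n, A = perm_diag_mx s (fun i => A i (s i)) &
    \prod_(i < n) A i (s i) = 1.
Proof.
move=> n0 detA Ainv.
have prodA (y : 'cV[R]_n) : 0 <= \prod_(i < n) y i ord0 ->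
    \prod_(i < n) (A *m y) i ord0 = \prod_(i < n) y i ord0.
  by move=> y0; apply: (real_root_inj_ge0 n0 y0); exact: Ainv.
have [|s As] := monomial_of_preserves_hyperplanes detA.
  move=> y j yj; have y0 : \prod_(i < n) y i ord0 = 0.
    by rewrite (bigD1 j)//= yj mul0r.
  by rewrite prodA y0.
exists s => //.
have one : \prod_(i < n) (const_mx 1 : 'cV[R]_n) i ord0 = 1.
  by apply: big1 => i _; rewrite mxE.
have := prodA (const_mx 1).
by rewrite one {1}As prod_perm_diag_mx_mul one mulr1; apply.
Qed.

(** * Constancy on connected sets and along segments *)

Lemma locally_constant_connected (T : topologicalType) (S : Type)
    (U : set T) (g : T -> S) : open U -> connected U ->
  (forall x, U x -> \forall z \near x, g z = g x) ->
  forall x y, U x -> U y -> g x = g y.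
Proof.
move=> oU cU gloc x y Ux Uy.
have openP (P : set S) : open (U `&` g @^-1` P).
  rewrite openE => z [Uz Pz]; apply: filterI; first exact: open_nbhs_nbhs.
  by near=> w; rewrite /preimage /= (near (gloc z Uz) w).
suff UE : U `&` g @^-1` [set g x] = U by move: Uy; rewrite -UE => -[_ ->].
apply: cU; first by exists x.
- by exists (U `&` g @^-1` [set g x]) => //; rewrite setIA setIid.
- exists (~` (U `&` g @^-1` (~` [set g x]))); first exact/open_closedC/openP.
  rewrite setCI setIUr setICr set0U -preimage_setC.
  by rewrite setCK.
Unshelve. all: by end_near. Qed.

Lemma ball_segment (R : realType) (V : normedModType R) (c u v : V) (r t : R) :
  ball c r u -> ball c r v -> 0 <= t <= 1 -> ball c r (u + t *: (v - u)).
Proof.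
rewrite -!ball_normE /= => cu cv /andP[t0 t1].
have -> : c - (u + t *: (v - u)) = (1 - t) *: (c - u) + t *: (c - v).
  rewrite (_ : c - v = (c - u) - (v - u)); last by rewrite opprB addrA subrK.
  by rewrite scalerBl scale1r [t *: (_ - _ - _)]scalerBr addrA subrK opprD
    addrA.
rewrite (le_lt_trans (ler_normD _ _))// !normrZ.
rewrite ger0_norm ?subr_ge0// ger0_norm//.
have [->|tn0] := eqVneq t 0; first by rewrite mul0r addr0 subr0 mul1r.
have tp : 0 < t by rewrite lt_def tn0.
rewrite [ltRHS](_ : r = (1 - t) * r + t * r); last first.
  by rewrite -mulrDl subrK mul1r.
by rewrite ler_ltD ?ltr_pM2l// ler_wpM2l ?subr_ge0// ltW.
Qed.

(** The mean value theorem for the restriction of [h] to the segment from [u] to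
    [u + d], whose derivative is the derivative of [h] in direction [d]. *)
Lemma increment_of_constant_derive (R : realType) (V : normedModType R)
    (h : V -> R) (u d : V) (c : R) :
  (forall t : R, 0 <= t <= 1 -> is_derive (u + t *: d) d h c) ->
  h (u + d) = h u + c.
Proof.
move=> hd; pose g (t : R) := h (u + t *: d).
have gd (t : R) : 0 <= t <= 1 -> is_derive t 1 g c.
  move=> /hd[]; rewrite /derivable /derive.
  rewrite (_ : (fun e : R => e^-1 *: ((h \o shift (u + t *: d)) (e *: d) -
    h (u + t *: d))) = (fun e : R => e^-1 *: ((g \o shift t) (e *: 1) - g t))).
    by move=> ? ?; exact: DeriveDef.
  apply/funext => e; rewrite /g /= [e *: 1]mulr1 scalerDl.
  by rewrite addrCA.
have [|||e _] := @MVT _ g (cst c) 0 1 => //.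
- move=> x; rewrite in_itv /= => /andP[/ltW x0 /ltW x1].
  by apply: gd; rewrite x0.
- apply: derivable_within_continuous => x; rewrite in_itv /= => x01.
  by have [] := gd x x01.
rewrite /g /= subr0 mulr1 scale1r scale0r addr0 => <-.
by rewrite subrKC.
Qed.

(** * Jacobian matrices *)

Lemma differentiable_component (R : realType) (n : nat)
    (f : 'cV[R]_n -> 'cV[R]_n) x i :
  differentiable f x -> differentiable (fun z => f z i ord0 : R) x.
Proof.
move=> df.
apply: (@differentiable_comp _ _ _ _ f (fun M : 'cV[R]_n => M i ord0 : R)) => //.
exact: differentiable_coord.
Qed.

Lemma derive_component (R : realType) (n : nat)
    (f : 'cV[R]_n -> 'cV[R]_n) x v i : differentiable f x ->
  'D_v (fun z => f z i ord0 : R) x = (jacobian_mx f x *m v) i ord0.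
Proof.
move=> /(differentiable_component i) df.
rewrite deriveE// {1}(matrix_sum_delta v) linear_sum mxE.
apply: eq_bigr => j _; rewrite big_ord1 linearZ mulrC.
by rewrite mxE /partial_derivative deriveE.
Qed.

Lemma jacobian_mx_affine (R : realType) (n : nat)
    (f : 'cV[R]_n -> 'cV[R]_n) x (A : 'M[R]_n) (b : 'cV[R]_n) :
  (\forall z \near x, f z = A *m z + b) -> jacobian_mx f x = A.
Proof.
move=> fA; apply/matrixP => i j; rewrite mxE /partial_derivative.
rewrite (near_eq_derive (g := fun z => (A *m z + b) i ord0 : R)); last first.
  by near=> z; rewrite (near fA z).
apply/lim_near_cst => //=; near=> h.
have h0 : h != 0 by near: h; exact: nbhs_dnbhs_neq.
rewrite mulmxDr -scalemxAr -colE !mxE -[X in X - _]addrA addrK.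
by rewrite [LHS]mulKf.
Unshelve. all: by end_near. Qed.

Lemma component_increment (R : realType) (n : nat)
    (f : 'cV[R]_n -> 'cV[R]_n) c r (i : 'I_n) u v (e : R) :
  (forall z, ball c r z -> differentiable f z) ->
  (forall z, ball c r z -> (jacobian_mx f z *m (v - u)) i ord0 = e) ->
  ball c r u -> ball c r v -> f v i ord0 = f u i ord0 + e.
Proof.
move=> fd fe cu cv; rewrite -{1}(subrKC u v).
apply: (increment_of_constant_derive (h := fun z => f z i ord0)) => t t01.
have cz := ball_segment cu cv t01.
apply: DeriveDef; first exact/diff_derivable/differentiable_component/fd.
by rewrite derive_component ?fe//; exact: fd.
Qed.

(** The derivative of the [i]-th component in direction [v - u] is the [(i, k)]
    entry of the Jacobian matrix times [v k - u k], that is, [0]. *)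
Lemma component_eq_in_box (R : realType) (n : nat)
    (f : 'cV[R]_n -> 'cV[R]_n) c r (i k : 'I_n) u v :
  (forall z, ball c r z -> differentiable f z) ->
  (forall z j, ball c r z -> j != k -> jacobian_mx f z i j = 0) ->
  ball c r u -> ball c r v -> u k ord0 = v k ord0 ->
  f v i ord0 = f u i ord0.
Proof.
move=> fd f0 cu cv uvk; rewrite -[RHS]addr0.
apply: (component_increment fd) => // z cz; rewrite mxE.
apply: big1 => j _; have [->|jk] := eqVneq j k.
  by rewrite !mxE uvk subrr mulr0.
by rewrite f0 ?mul0r.
Qed.

Lemma derive_translation (R : numFieldType) (V W : normedModType R)
    (h : V -> W) (d u w : V) :
  'D_w (fun z => h (z + d)) u = 'D_w h (u + d).
Proof.
rewrite /derive (_ : (fun e : R => _) =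
  fun e : R => e^-1 *: ((h \o shift (u + d)) (e *: w) - h (u + d)))//.
by apply/funext => e /=; rewrite addrA.
Qed.

(** Near [u], the [i]-th component coincides with its translate by [v - u], so
    that its partial derivatives at [u] and [v] coincide. *)
Lemma jacobian_mx_eq_in_box (R : realType) (n : nat)
    (f : 'cV[R]_n -> 'cV[R]_n) c r (i k : 'I_n) u v :
  (forall z, ball c r z -> differentiable f z) ->
  (forall z j, ball c r z -> j != k -> jacobian_mx f z i j = 0) ->
  ball c r u -> ball c r v -> u k ord0 = v k ord0 ->
  jacobian_mx f u i k = jacobian_mx f v i k.
Proof.
move=> fd f0 cu cv uvk; rewrite !mxE /partial_derivative.
rewrite (near_eq_derive (g := fun z => f (z + (v - u)) i ord0 : R)); last first.
  have nu : \forall z \near u, ball c r z.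
    by apply: open_nbhs_nbhs; split=> //; exact: ball_open.
  have nv : \forall z \near u, ball c r (z + (v - u)).
    have : z + (v - u) @[z --> u] --> u + (v - u).
      exact: (cvgD cvg_id (cvg_cst _)).
    apply; rewrite subrKC; apply: open_nbhs_nbhs; split=> //; exact: ball_open.
  near=> z; apply: (component_eq_in_box fd f0).
  - by near: z.
  - by near: z.
  - by rewrite !mxE uvk subrr addr0.
by rewrite (derive_translation (fun z => f z i ord0)) subrKC.
Unshelve. all: by end_near. Qed.

(** The entry [(i, s i)] depends only on the coordinate [s i], while the
    product relation expresses it through entries that do not depend on that
    coordinate. *)
Lemma jacobian_mx_box_constant (R : realType) (n : nat)
    (f : 'cV[R]_n -> 'cV[R]_n) c r (s : 'S_n) u v :
  (forall z, ball c r z -> differentiable f z) ->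
  (forall z i j, ball c r z -> j != s i -> jacobian_mx f z i j = 0) ->
  (forall z, ball c r z -> \prod_(i < n) jacobian_mx f z i (s i) = 1) ->
  ball c r u -> ball c r v -> jacobian_mx f u = jacobian_mx f v.
Proof.
move=> fd f0 f1 cu cv; apply/matrixP => i j.
have [->|jsi] := eqVneq j (s i); last by rewrite !(f0 _ i).
have r0 : 0 < r by case: cu.
(* Passing from [u] to [w] preserves the coordinate [s i], and passing from [w]
   to [v] preserves all the others; [w] stays in the ball because balls of
   matrices are boxes. *)
pose w : 'cV[R]_n := \col_k (if k == s i then u k ord0 else v k ord0).
have cw : ball c r w.
  split=> // k l; rewrite mxE (ord1 l).
  by case: ifP => _; [apply: cu.2|apply: cv.2].
transitivity (jacobian_mx f w i (s i)).
  apply: (jacobian_mx_eq_in_box fd) => //; last by rewrite mxE eqxx.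
  by move=> z k; exact: f0.
have eqk k : k != i -> jacobian_mx f w k (s k) = jacobian_mx f v k (s k).
  move=> ki; apply: (jacobian_mx_eq_in_box fd) => //.
    by move=> z l; exact: f0.
  by rewrite mxE (inj_eq perm_inj) (negPf ki).
have P0 : \prod_(k < n | k != i) jacobian_mx f v k (s k) != 0.
  apply: contra_eq_neq (f1 v cv) => Pv; rewrite (bigD1 i)//= Pv mulr0.
  by rewrite eq_sym oner_neq0.
have := etrans (f1 w cw) (esym (f1 v cv)).
rewrite (bigD1 i)//= [RHS](bigD1 i)//=.
under eq_bigr do rewrite eqk//.
exact: (mulIf P0).
Qed.

(** * Coordinate changes leaving the Berwald-Moor metric invariant *)

Section InvariantChange.
Variables (R : realType) (n : nat) (n_gt0 : (0 < n)%N).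
Variables (U : set 'cV[R]_n) (f : 'cV[R]_n -> 'cV[R]_n).
Hypotheses (fU : coordinate_change U f)
  (finv : leaves_berwald_moor_invariant U f).

Let J := jacobian_mx f.

Lemma jacobian_mx_monomial x : U x ->
  exists2 s : 'S_n, J x = perm_diag_mx s (fun i => J x i (s i)) &
    \prod_(i < n) J x i (s i) = 1.
Proof.
move=> Ux; apply: monomial_of_preserves_berwald_moor => //.
  exact: coordinate_change_det fU _ Ux.
by move=> y; exact: finv.
Qed.

(** The permutation at a nearby point is the same as at [x], because the entries
    [(i, s i)] remain nonzero by continuity; the coefficients are then constant
    on a box. *)
Lemma jacobian_mx_locally_constant x : U x -> \forall z \near x, J z = J x.
Proof.
move=> Ux; have [s Jx Jx1] := jacobian_mx_monomial Ux.
have Jxs i : J x i (s i) != 0.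
  apply/eqP => Ji0; move/eqP: Jx1; rewrite (bigD1 i)//= Ji0 mul0r.
  by rewrite eq_sym oner_eq0.
have nU : \forall z \near x, U z.
  by apply: open_nbhs_nbhs; split=> //; exact: coordinate_change_open fU.
have nJ : \forall z \near x, forall i, J z i (s i) != 0.
  have := @filter_forall _ _ (fun (i : 'I_n) z => J z i (s i) != 0) (nbhs x) _.
  apply=> i.
  have Jc := @coordinate_change_C1 _ _ _ _ fU i (s i) x Ux.
  have Ji0 : partial_derivative f i (s i) x != 0.
    by have := Jxs i; rewrite /J mxE.
  near=> z; rewrite /J mxE; near: z; exact: (cvgr_neq0 _ Jc Ji0).
have /nbhs_ballP[r /= r0 Br] :
    \forall z \near x, U z /\ forall i, J z i (s i) != 0.
  by apply: filterI.
have Jz z : ball x r z -> J z = perm_diag_mx s (fun i => J z i (s i)) /\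
   \prod_(i < n) J z i (s i) = 1.
  move=> /Br[Uz Jzs]; have [s' Jz Jz1] := jacobian_mx_monomial Uz.
  suff -> : s = s' by [].
  apply/permP => i; apply/eqP; apply: contraNT (Jzs i) => ss'.
  by rewrite Jz mxE (negPf ss').
near=> z; apply: (@jacobian_mx_box_constant _ _ f x r s).
- by move=> w /Br[Uw _]; exact: coordinate_change_differentiable fU _ Uw.
- by move=> w i j /Jz[] + _ ji; rewrite /J => ->; rewrite mxE (negPf ji).
- by move=> w /Jz[].
- by near: z; exact: nbhsx_ballx.
- exact: ballxx.
Unshelve. all: by end_near. Qed.

Lemma affine_of_jacobian_mx_constant A : (forall x, U x -> J x = A) ->
  forall x y, U x -> U y -> f x - A *m x = f y - A *m y.
Proof.
move=> JA; apply: locally_constant_connected.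
- exact: coordinate_change_open fU.
- exact: coordinate_change_connected fU.
move=> x Ux.
have /nbhs_ballP[r /= r0 Br] : \forall z \near x, U z.
  by apply: open_nbhs_nbhs; split=> //; exact: coordinate_change_open fU.
near=> z; have xz : ball x r z by near: z; exact: nbhsx_ballx.
suff -> : f z = f x + A *m (z - x).
  by rewrite mulmxBr addrA addrAC addrK.
apply/colP => i; rewrite mxE.
apply: (component_increment (c := x) (r := r)) => //; last exact: ballxx.
  by move=> w /Br Uw; exact: coordinate_change_differentiable fU _ Uw.
by move=> w /Br Uw; rewrite -/(J w) JA.
Unshelve. all: by end_near. Qed.

End InvariantChange.

Theorem theorem1 (R : realType) (n : nat) (n_ge3 : (3 <= n)%N)
    (U : set 'cV[R]_n) (Xt : 'cV[R]_n -> 'cV[R]_n)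
    (Xt_change : coordinate_change U Xt) :
  leaves_berwald_moor_invariant U Xt <->
  exists (a : 'I_n -> R) (s : 'S_n) (X0 : 'cV[R]_n),
    \prod_(i < n) a i = 1 /\
    forall X : 'cV[R]_n, U X -> Xt X = perm_diag_mx s a *m X + X0.
Proof.
have n_gt0 : (0 < n)%N by exact: leq_trans n_ge3.
split=> [inv|[a [s [X0 [a1 XtE]]]] x y Ux]; last first.
  have -> : (tangent_change Xt (x, y)).2 = perm_diag_mx s a *m y.
    rewrite /tangent_change /=.
    rewrite (jacobian_mx_affine (A := perm_diag_mx s a) (b := X0))//.
    have : \forall z \near x, U z.
      apply: open_nbhs_nbhs; split=> //.
      exact: coordinate_change_open Xt_change.
    by apply: filterS => z; exact: XtE.
  by rewrite /berwald_moor prod_perm_diag_mx_mul a1 mul1r.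
have [[x Ux]|U0] := pselect (U !=set0); last first.
  exists (fun=> 1), 1%g, 0; split; first exact: big1.
  by move=> X UX; exfalso; apply: U0; exists X.
have [s Jx Jx1] := jacobian_mx_monomial n_gt0 Xt_change inv Ux.
exists (fun i => jacobian_mx Xt x i (s i)), s, (Xt x - jacobian_mx Xt x *m x).
split=> // X UX; rewrite -Jx.
have JE z : U z -> jacobian_mx Xt z = jacobian_mx Xt x.
  move=> Uz; apply: (locally_constant_connected (U := U)) => //.
  - exact: coordinate_change_open Xt_change.
  - exact: coordinate_change_connected Xt_change.
  - exact: jacobian_mx_locally_constant.
by rewrite -(affine_of_jacobian_mx_constant Xt_change JE UX Ux) addrC subrK.
Qed.
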